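(* Let $\alpha\in\mathbb{R}$. (i) The function $x\mapsto \dfrac{x^\alpha}{[\Gamma(x+1)]^{1/x}}$ is logarithmically completely monotonic on $(0,\infty)$ if and only if $\alpha\le 0$. (ii) The function $x\mapsto \dfrac{[\Gamma(x+1)]^{1/x}}{x^\alpha}$ is logarithmically completely monotonic on $(0,\infty)$ if and only if $\alpha\ge 1$.
   Context: A positive function $f$ on an interval $I$ is called logarithmically completely monotonic on $I$ if it has derivatives of all orders on $I$ and $(-1)^n[\ln f(x)]^{(n)}\ge 0$ for all $x\in I$ and all $n\in\mathbb{N}=\{1,2,\dots\}$. $\Gamma$ is the Euler gamma function. *)

(* Defs.v *)
From mathcomp Require Import all_boot all_order all_algebra.
From mathcomp Require Import all_classical all_reals all_analysis.
Import Order.TTheory GRing.Theory Num.Theory.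
Import numFieldNormedType.Exports.

Set Implicit Arguments.
Unset Strict Implicit.
Unset Printing Implicit Defensive.

Local Open Scope classical_set_scope.
Local Open Scope ring_scope.

(* Euler's integral of the second kind. It equals the gamma function for
   0 < x only: for x <= 0 the integral diverges and [Rintegral] returns 0. *)
Definition Gamma (R : realType) (x : R) : R :=
  \int[@lebesgue_measure R]_(t in `]0, +oo[) (t `^ (x - 1) * expR (- t)).

(* Meant for an open interval I: the derivatives are two-sided. *)
Definition log_completely_monotonic (R : realType) (I : set R) (f : R -> R)
    : Prop :=
  [/\ forall x, I x -> 0 < f x,
      forall (n : nat) x, I x -> derivable (f^`(n)%classic) x 1
    & forall (n : nat) x, (0 < n)%N -> I x ->
        0 <= (-1) ^+ n * ((fun y => ln (f y))^`(n)%classic) x].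

(* Main.v *)
Require Import Defs.
From mathcomp Require Import all_boot all_order all_algebra.
From mathcomp Require Import all_classical all_reals all_analysis.
From mathcomp Require Import measurable_realfun ring lra.
Import Order.TTheory GRing.Theory Num.Theory.
Import numFieldNormedType.Exports.

Local Open Scope classical_set_scope.
Local Open Scope ring_scope.

Set Implicit Arguments.
Unset Strict Implicit.
Unset Printing Implicit Defensive.

(* Put L x = ln (Gamma (x + 1)) and g x = L x / x. Integrating tangent-line
   bounds of powers against e^-t gives
   a^x Gamma (a + 1) <= Gamma (a + x + 1) <= (a + x + 1)^x Gamma (a + 1), which
   together with the functional equation yields Gauss's limit formula
   L x = lim_N x ln N + sum_(k <= N) (ln k - ln (x + k)). It can be
   differentiated termwise because all derivatives of order at least 2 of the
   approximants are bounded uniformly in N, and telescoping gives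
   0 <= (-1)^n L^(n+2) x <= n! / x^(n+1).
   Since (x^(n+1) g^(n))' = x^n L^(n+1) and x^(n+1) g^(n) vanishes at 0,
   integration turns this into 0 <= (-1)^n g^(n+1) x <= n! / x^(n+1), where the
   right-hand side is (-1)^n ln^(n+1) x; both sufficiency claims follow.
   Conversely, the case n = 1 makes alpha ln - g, resp. g - alpha ln,
   nonincreasing: this contradicts g >= -1 near 0 if alpha > 0, resp.
   L N >= N ln N - N for large N if alpha < 1. *)

(** * Derivatives on the positive half-line *)

Definition derives_pos (R : realType) (f f' : R -> R) :=
  forall x : R, 0 < x -> is_derive x 1 f (f' x).

Lemma is_derive_eq_pos (R : realType) (f g : R -> R) (x d : R) :
  (forall y, 0 < y -> f y = g y) -> 0 < x ->
  is_derive x 1 f d -> is_derive x 1 g d.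
Proof.
move=> fg x0; apply: near_eq_is_derive.
by near=> y; apply: fg; near: y; exact: lt_nbhsr.
Unshelve. all: by end_near. Qed.

(** The iterated derivative is a function on the whole line, but the half-line is open, so agreement
    there alone determines the next derivative. *)
Lemma derive1n_tower (R : realType) (D : nat -> R -> R) (f : R -> R) :
  (forall n, derives_pos (D n) (D n.+1)) ->
  (forall x, 0 < x -> f x = D 0%N x) ->
  forall n x, 0 < x -> (f^`(n))%classic x = D n x.
Proof.
move=> Dder fD; elim=> [|n IHn] x x0; first exact: fD.
rewrite derive1nS derive1E; apply: derive_val.
apply: (@is_derive_eq_pos _ (D n)) => //; last exact: Dder.
by move=> y y0; rewrite IHn.
Qed.

(** Leaving the derivatives existential lets closure under products and [expR] go by induction,
    without a formula for the [n]-th derivative. *)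
Fixpoint smooth_pos (R : realType) n (f : R -> R) : Prop :=
  if n is m.+1 then exists2 f', derives_pos f f' & smooth_pos m f' else True.

Lemma smooth_pos_eq (R : realType) n (f g : R -> R) :
  (forall y, 0 < y -> f y = g y) -> smooth_pos n f -> smooth_pos n g.
Proof.
case: n => // n fg [f' ff' sf]; exists f' => // x x0.
exact: is_derive_eq_pos (ff' x x0).
Qed.

Lemma smooth_posW (R : realType) n (f : R -> R) :
  smooth_pos n.+1 f -> smooth_pos n f.
Proof.
by elim: n f => // n IHn f [f' ff' sf]; exists f' => //; exact: IHn.
Qed.

Lemma smooth_posD (R : realType) n (f g : R -> R) :
  smooth_pos n f -> smooth_pos n g -> smooth_pos n (f + g).
Proof.
elim: n f g => // n IHn f g [f' ff' sf] [g' gg' sg].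
exists (f' + g'); last exact: IHn.
by move=> x x0; apply: is_deriveD; [exact: ff'|exact: gg'].
Qed.

Lemma smooth_posM (R : realType) n (f g : R -> R) :
  smooth_pos n f -> smooth_pos n g -> smooth_pos n (f * g).
Proof.
elim: n f g => // n IHn f g sf sg.
have [sf1 sg1] := (smooth_posW sf, smooth_posW sg).
case: sf sg => [f' ff' sf] [g' gg' sg].
exists (f * g' + g * f'); last by apply: smooth_posD; exact: IHn.
by move=> x x0; apply: is_deriveM; [exact: ff'|exact: gg'].
Qed.

Lemma smooth_pos_expR (R : realType) n (h : R -> R) :
  smooth_pos n h -> smooth_pos n (fun x => expR (h x)).
Proof.
elim: n => // n IHn sh; have sh1 := smooth_posW sh.
case: sh => h' hh' sh.
exists ((fun x => expR (h x)) * h'); last by apply: smooth_posM => //; exact: IHn.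
by move=> x x0; apply: is_derive1_comp; exact: hh'.
Qed.

Lemma smooth_pos_tower (R : realType) (D : nat -> R -> R) :
  (forall n, derives_pos (D n) (D n.+1)) -> forall m n, smooth_pos m (D n).
Proof. by move=> Dder; elim=> // m IHm n; exists (D n.+1). Qed.

Lemma smooth_pos_derivable (R : realType) n (f : R -> R) (x : R) :
  smooth_pos n.+1 f -> 0 < x -> derivable (f^`(n))%classic x 1.
Proof.
elim: n f => [|n IHn] f [f' ff' sf] x0.
  by have [] := ff' x x0.
rewrite derive1Sn; apply: IHn x0; apply: (@smooth_pos_eq _ n.+1 f' _ _ sf) => y y0.
by rewrite derive1E; apply/esym/derive_val/ff'.
Qed.

(** The points come in either order, so the location of [c] is recorded as a distance bound, the
    form in which [taylor1_pos] uses it. *)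
Lemma MVT_pos (R : realType) (f f' : R -> R) (x y : R) :
  derives_pos f f' -> 0 < x -> 0 < y ->
  exists c, [/\ 0 < c, `|c - x| <= `|y - x| & f y - f x = f' c * (y - x)].
Proof.
move=> ff'.
have inc a b : a <= b -> 0 < a ->
    exists2 c, c \in `[a, b]%R & f b - f a = f' c * (b - a).
  move=> ab a0; apply: MVT_segment => // [z|].
    by rewrite in_itv/= => /andP[az _]; apply: ff'; exact: lt_trans az.
  apply: derivable_within_continuous => z.
  by rewrite in_itv/= => /andP[az _]; case: (ff' z (lt_le_trans a0 az)).
move=> x0 y0; have [xy|/ltW yx] := leP x y.
  have [c] := inc _ _ xy x0.
  rewrite in_itv/= => /andP[xc cy] fE; exists c; split => //.
    exact: lt_le_trans xc.
  by rewrite !ger0_norm ?subr_ge0// lerD2r.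
have [c] := inc _ _ yx y0.
rewrite in_itv/= => /andP[yc cx] fE; exists c; split => //.
- exact: lt_le_trans yc.
- by rewrite !ler0_norm ?subr_le0// !opprB lerD2l lerN2.
- by rewrite -(opprB x y) mulrN -fE opprB.
Qed.

Lemma taylor1_pos (R : realType) (f f' f'' : R -> R) (B x y : R) :
  derives_pos f f' -> derives_pos f' f'' ->
  (forall z, 0 < z -> `|f'' z| <= B) -> 0 < x -> 0 < y ->
  `|f y - f x - (y - x) * f' x| <= B * (y - x) ^+ 2.
Proof.
move=> ff' ff'' fB x0 y0.
have [c [c0 cx ->]] := MVT_pos ff' x0 y0.
have [d [d0 dx fcE]] := MVT_pos ff'' x0 c0.
rewrite (mulrC (y - x)) -mulrBl fcE !normrM -(real_normK (num_real (y - x))) expr2 mulrA.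
by rewrite ler_wpM2r// ler_pM// fB.
Qed.

Lemma nondecreasing_pos (R : realType) (f f' : R -> R) (x y : R) :
  derives_pos f f' -> (forall z, 0 < z -> 0 <= f' z) ->
  0 < x -> x <= y -> f x <= f y.
Proof.
move=> ff' f'0 x0 xy.
have [c [c0 _ fE]] := MVT_pos ff' x0 (lt_le_trans x0 xy).
by rewrite -subr_ge0 fE mulr_ge0 ?f'0// subr_ge0.
Qed.

(** A nondecreasing function is nonnegative if its limit at 0 is; the linear lower bound expresses
    this without mentioning a limit. *)
Lemma nonneg_pos (R : realType) (f f' : R -> R) (C : R) :
  derives_pos f f' -> (forall z, 0 < z -> 0 <= f' z) ->
  (forall y, 0 < y <= 1 -> - (C * y) <= f y) -> forall x, 0 < x -> 0 <= f x.
Proof.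
move=> ff' f'0 fC x x0; rewrite leNgt; apply/negP => fx0.
(* With this [y], [f y >= - (C * y) >= f x / 2 > f x], against monotonicity. *)
pose y := Num.min x (Num.min 1 (- f x / (2 * (`|C| + 1)))).
have C1 : 0 < `|C| + 1 by rewrite ltr_wpDl.
have y0 : 0 < y.
  by rewrite !lt_min x0 ltr01 divr_gt0 ?oppr_gt0 ?mulr_gt0.
have yx : y <= x by rewrite ge_min lexx.
have y1 : y <= 1 by rewrite !ge_min lexx orbT.
have yC : y <= - f x / (2 * (`|C| + 1)) by rewrite !ge_min lexx !orbT.
have := nondecreasing_pos ff' f'0 y0 yx.
have : - (C * y) <= f y by apply: fC; rewrite y0 y1.
have : C * y <= (`|C| + 1) * y.
  by rewrite ler_wpM2r ?(ltW y0)// (le_trans (ler_norm C))// lerDl.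
have : (`|C| + 1) * y <= - f x / 2.
  by rewrite mulrC -ler_pdivlMr// -mulrA -invfM.
lra.
Qed.

(** * Termwise differentiation of limits under second-order bounds *)

Lemma cauchy_derivative (R : realType) (F F1 F2 : nat -> R -> R) (B x : R) :
  (forall N, derives_pos (F N) (F1 N)) ->
  (forall N, derives_pos (F1 N) (F2 N)) ->
  (forall N z, 0 < z -> `|F2 N z| <= B) ->
  (forall z, 0 < z -> cvgn (F ^~ z)) -> 0 < x -> cvgn (F1 ^~ x).
Proof.
move=> d1 d2 FB cF x0; apply/cauchy_cvgP; apply: cauchy_exP => e e0.
have B0 : 0 <= B by apply: le_trans (FB 0%N 1 ltr01).
(* The difference quotient with step [h] is within [B * h] of [F1 N x], uniformly in [N]. This [h]
   makes each of the two Taylor errors at most [e * h / 4]; the four distances to the limits add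
   less than [e * h / 4] in total. *)
pose h := e / (4 * (B + 1)).
have B1 : 0 < B + 1 by rewrite ltr_wpDl.
have h0 : 0 < h by rewrite divr_gt0// mulr_gt0.
have xh0 : 0 < x + h by rewrite addr_gt0.
have eh0 : 0 < e * h / 16 by rewrite divr_gt0// mulr_gt0.
have /cvgrPdist_lt/(_ _ eh0) cx := cF x x0.
have /cvgrPdist_lt/(_ _ eh0) cxh := cF _ xh0.
have [M _ cxx] := filterI cx cxh.
exists (F1 M x); exists M => // N /= MN; rewrite /ball/=.
have /= [] := cxx _ MN; have /= [] := cxx M (leqnn M).
have := taylor1_pos (d1 N) (d2 N) (FB N) x0 xh0.
have := taylor1_pos (d1 M) (d2 M) (FB M) x0 xh0.
have -> : x + h - x = h by ring.
set l1 := lim _; set l2 := lim _ => tM tN a1 a2 a3 a4.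
have Bh : B * h ^+ 2 <= e * h / 4.
  have -> : e * h / 4 = (B + 1) * h ^+ 2.
    by rewrite /h; field; rewrite gt_eqF.
  by rewrite ler_wpM2r// ?sqr_ge0// lerDl.
have : `|h * (F1 M x - F1 N x)| < h * e.
  move: tM tN a1 a2 a3 a4.
  rewrite !ler_norml !ltr_norml.
  move=> /andP[? ?] /andP[? ?] /andP[? ?] /andP[? ?] /andP[? ?] /andP[? ?].
  by apply/andP; split; rewrite ?mulrBr; lra.
by rewrite normrM (gtr0_norm h0) ltr_pM2l.
Qed.

Lemma is_derive_quadratic (R : realType) (f : R -> R) (x d B : R) :
  0 < x -> (forall y, 0 < y -> `|f y - f x - (y - x) * d| <= B * (y - x) ^+ 2) ->
  is_derive x 1 f d.
Proof.
move=> x0 fB.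
have B0 : 0 <= B.
  have /fB : 0 < x + 1 by rewrite addr_gt0.
  have -> : x + 1 - x = 1 by ring.
  by rewrite expr1n mulr1; exact: le_trans.
suff cvg_d : h^-1 *: (f (h *: 1 + x) - f x) @[h --> 0^'] --> d.
  by split; [apply/cvg_ex; exists d|exact/cvg_lim].
apply/cvgrPdist_le => e e0; near=> h.
have hN0 : h != 0 by near: h; exact: nbhs_dnbhs_neq.
have hx : `|h| < x by near: h; apply: dnbhs0_lt.
have he : `|h| < e / (B + 1) by near: h; apply: dnbhs0_lt; rewrite divr_gt0// ltr_wpDl.
have xh0 : 0 < h + x.
  by move: hx; rewrite ltr_norml => /andP[+ _]; lra.
rewrite distrC /GRing.scale/= mulr1.
have -> : h^-1 * (f (h + x) - f x) - d = h^-1 * (f (h + x) - f x - h * d).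
  by field.
rewrite normrM normfV ler_pdivrMl ?normr_gt0//.
have := fB _ xh0; rewrite addrK => /le_trans; apply.
rewrite -(real_normK (num_real h)) expr2 mulrCA ler_wpM2l//.
move: he; rewrite ltr_pdivlMr ?ltr_wpDl// => /ltW/(le_trans _); apply.
by rewrite mulrC ler_wpM2l// lerDl.
Unshelve. all: by end_near. Qed.

(** The constant [B] does not depend on [N], so the Taylor estimate passes to the limit, and a
    quadratic error identifies the derivative. *)
Lemma limit_derivative (R : realType) (F F1 F2 : nat -> R -> R) (B : R) :
  (forall N, derives_pos (F N) (F1 N)) ->
  (forall N, derives_pos (F1 N) (F2 N)) ->
  (forall N z, 0 < z -> `|F2 N z| <= B) ->
  (forall z, 0 < z -> cvgn (F ^~ z)) ->
  derives_pos (fun x => limn (F ^~ x)) (fun x => limn (F1 ^~ x)).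
Proof.
move=> d1 d2 FB cF x x0; apply: (@is_derive_quadratic _ _ _ _ B) => // y y0.
have cF1 : cvgn (F1 ^~ x) by exact: cauchy_derivative d1 d2 FB cF x0.
have cG : F N y - F N x - (y - x) * F1 N x @[N --> \oo] -->
    limn (F ^~ y) - limn (F ^~ x) - (y - x) * limn (F1 ^~ x).
  by apply: cvgB; [apply: cvgB; exact: cF|exact: cvgMl_tmp].
apply: (cvgr_to_le (cvg_norm cG)); apply: nearW => N.
exact: taylor1_pos (d1 N) (d2 N) (FB N) x0 y0.
Qed.

(** Convergence climbs one order at a time: order [n] converges and order [n.+2] is bounded, hence
    order [n.+1] converges. *)
Lemma limit_tower (R : realType) (T : nat -> nat -> R -> R) (B : nat -> R) :
  (forall N n, derives_pos (T N n) (T N n.+1)) ->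
  (forall N n x, 0 < x -> `|T N n.+2 x| <= B n) ->
  (forall x, 0 < x -> cvgn (fun N => T N 0%N x)) ->
  (forall n x, 0 < x -> cvgn (fun N => T N n x)) /\
  (forall n, derives_pos (fun x => limn (fun N => T N n x))
                         (fun x => limn (fun N => T N n.+1 x))).
Proof.
move=> dT TB cT0.
have cT n : forall x, 0 < x -> cvgn (fun N => T N n x).
  elim: n => // n IHn x x0.
  exact: (cauchy_derivative (dT^~ n) (dT^~ n.+1) (TB^~ n) IHn x0).
split=> // n.
exact: (limit_derivative (dT^~ n) (dT^~ n.+1) (TB^~ n) (cT n)).
Qed.

(** * The gamma integral *)

Definition powR_expRN (R : realType) (a t : R) : R := t `^ a * expR (- t).

(** For [0 < a], raising [u <= expR u] at [u = t / (2 * a)] to the power [a] gives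
    [t^a <= (2a)^a e^(t/2)]. *)
Lemma powR_expRN_bound (R : realType) (a : R) : 0 <= a ->
  exists2 C, 0 <= C & forall t, 0 <= t -> powR_expRN a t <= C * expR (- (2^-1 * t)).
Proof.
rewrite le_eqVlt => /predU1P[<-|a0].
  exists 1 => // t t0; rewrite /powR_expRN powRr0 !mul1r ler_expR; lra.
exists ((2 * a) `^ a); first exact: powR_ge0.
move=> t t0; rewrite /powR_expRN.
have a20 : 0 < 2 * a by rewrite mulr_gt0.
have -> : t = 2 * a * (t / (2 * a)) by field; rewrite gt_eqF.
set u := t / (2 * a); have u0 : 0 <= u by rewrite divr_ge0// ltW.
rewrite powRM// ?(ltW a20)// -mulrA ler_wpM2l ?powR_ge0//.
have -> : - (2^-1 * (2 * a * u)) = u * a - 2 * a * u by field.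
rewrite expRD ler_wpM2r ?expR_ge0// expRM ge0_ler_powR ?nnegrE ?expR_ge0 ?(ltW a0)//.
by apply: le_trans (expR_ge1Dx u); rewrite lerDr.
Qed.

Lemma measurable_powR_expRN (R : realType) (a : R) :
  measurable_fun setT (@powR_expRN R a).
Proof.
apply: measurable_funM; first exact: measurable_powR.
by apply: measurableT_comp => //; exact: measurable_funN.
Qed.

Lemma expRN_scale_cvgy (R : realType) (k : R) : 0 < k ->
  expR (- (k * x)) @[x --> +oo] --> (0 : R).
Proof.
move=> k0; apply: (@cvg_comp _ _ _ (fun x => k * x) (fun x => expR (- x)) _ (pinfty_nbhs R)).
  exact: gt0_cvgMry.
exact: cvgr_expR.
Qed.

Lemma powR_expRN_cvgy (R : realType) (a : R) : 0 <= a ->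
  powR_expRN a x @[x --> +oo] --> (0 : R).
Proof.
move=> a0; have [C C0 aC] := powR_expRN_bound a0.
apply: (@squeeze_cvgr _ _ _ _ (cst 0) (fun t => C * expR (- (2^-1 * t)))).
- near=> t; rewrite aC ?mulr_ge0 ?powR_ge0 ?expR_ge0//=.
- exact: cvg_cst.
- by rewrite -[0](mulr0 C); apply: cvgMl_tmp; exact: expRN_scale_cvgy.
Unshelve. all: by end_near. Qed.

Lemma continuous_expRN_scale (R : realType) (k : R) :
  continuous (fun x : R => expR (- (k * x))).
Proof.
move=> x; apply: continuous_comp; last exact: continuous_expR.
by apply: continuousN; apply: mulrl_continuous.
Qed.

Lemma is_derive_expRN_scale (R : realType) (k x : R) :
  is_derive x 1 (fun x : R => expR (- (k * x))) (- (k * expR (- (k * x)))).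
Proof.
have h : is_derive x 1 (fun x : R => - (k * x)) (- k).
  by apply: is_derive_eq; rewrite scaler1.
have := is_derive1_comp (f := expR) (g := fun x : R => - (k * x)) (is_derive_expR _) h.
by rewrite mulrN mulrC.
Qed.

Lemma is_derive_powR_expRN (R : realType) (a t : R) : 0 < t ->
  is_derive t 1 (powR_expRN (a + 1)) ((a + 1) * powR_expRN a t - powR_expRN (a + 1) t).
Proof.
move=> t0; rewrite /powR_expRN.
have h1 := @is_derive1_powR R (a + 1) t t0.
have h2 : is_derive t 1 (fun x : R => expR (- x)) (- expR (- t)).
  have := is_derive_expRN_scale 1 t.
  by under eq_fun do rewrite mul1r; rewrite !mul1r.
have := is_deriveM h1 h2.
rewrite addrK => /is_derive_eq; apply.
by rewrite /GRing.scale/=; ring.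
Qed.

Lemma powR_expRN_cvg0 (R : realType) (a : R) : 0 <= a ->
  powR_expRN a x @[x --> 0^'+] --> powR_expRN a 0.
Proof.
move=> a0; apply: cvgM; last first.
  apply: cvg_at_right_filter; apply: continuous_comp; last exact: continuous_expR.
  exact: opp_continuous.
move: a0; rewrite le_eqVlt => /predU1P[<-|a0].
  by under eq_fun do rewrite powRr0; rewrite powRr0; exact: cvg_cst.
by rewrite powR0 ?gt_eqF//; exact: powR_cvg0.
Qed.

Lemma powR_expRN_continuous (R : realType) (a x : R) : 0 < x ->
  {for x, continuous (powR_expRN a)}.
Proof.
move=> x0; apply: differentiable_continuous; apply/derivable1_diffP.
have := is_derive_powR_expRN (a - 1) x0; by rewrite subrK => -[].
Qed.

Lemma integral_expRN_scale (R : realType) (k : R) : 0 < k ->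
  (\int[@lebesgue_measure R]_(t in `[0%R, +oo[) (expR (- (k * t)))%:E = (k^-1)%:E)%E.
Proof.
move=> k0.
rewrite (@ge0_continuous_FTC2y _ _ (fun t => - k^-1 * expR (- (k * t))) _ 0).
- by rewrite mulr0 oppr0 expR0 mulr1 -EFinB sub0r opprK.
- by move=> x _; exact: expR_ge0.
- apply/continuous_within_itvcyP; split => [x _|].
    exact: continuous_expRN_scale.
  by apply: cvg_at_right_filter; exact: continuous_expRN_scale.
- by rewrite -[0](mulr0 (- k^-1)); apply: cvgMl_tmp; exact: expRN_scale_cvgy.
- move=> x x0; apply: derivableM => //; apply: ex_derive; exact: is_derive_expRN_scale.
- by apply: cvgMl_tmp; apply: cvg_at_right_filter; exact: continuous_expRN_scale.
- move=> x _; rewrite derive1E.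
  have h := is_deriveZ (- k^-1) (is_derive_expRN_scale k x).
  rewrite (@derive_val _ _ _ _ _ _ _ h) /GRing.scale/=.
  by field; rewrite gt_eqF.
Qed.

Lemma integrable_expRN_scale (R : realType) (k : R) : 0 < k ->
  (@lebesgue_measure R).-integrable `[0, +oo[ (EFin \o (fun t => expR (- (k * t)))).
Proof.
move=> k0; apply/integrableP; split.
  apply/measurable_EFinP; apply: measurable_funTS.
  by apply: continuous_measurable_fun; exact: continuous_expRN_scale.
under eq_integral do rewrite /= ger0_norm ?expR_ge0//.
by rewrite integral_expRN_scale// ltry.
Qed.

Lemma integrable_powR_expRN (R : realType) (a : R) : 0 <= a ->
  (@lebesgue_measure R).-integrable `[0, +oo[ (EFin \o (powR_expRN a)).
Proof.
move=> a0; have [C C0 aC] := powR_expRN_bound a0.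
have iC : (@lebesgue_measure R).-integrable `[0, +oo[
    (EFin \o (fun t => C * expR (- (2^-1 * t)))).
  have h2 : (0 : R) < 2^-1 by [].
  exact: (integrableZl _ C (integrable_expRN_scale h2)).
apply: (le_integrable _ _ _ iC) => //.
  apply/measurable_EFinP; apply: measurable_funTS.
  exact: measurable_powR_expRN.
move=> t /=; rewrite in_itv/= andbT => t0.
rewrite lee_fin !ger0_norm ?aC ?mulr_ge0 ?expR_ge0 ?powR_ge0//.
Qed.

Lemma integrable_powR_expRN_oy (R : realType) (a : R) : 0 <= a ->
  (@lebesgue_measure R).-integrable `]0, +oo[ (EFin \o (powR_expRN a)).
Proof.
move=> a0; apply: (integrableS _ _ _ (integrable_powR_expRN a0)) => //.
by apply: subset_itvr; rewrite bnd_simp.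
Qed.

Lemma GammaD1E (R : realType) (a : R) :
  Gamma (a + 1) = \int[@lebesgue_measure R]_(t in `]0, +oo[) powR_expRN a t.
Proof. by rewrite /Gamma addrK. Qed.

Lemma Gamma1 (R : realType) : Gamma (1 : R) = 1.
Proof.
rewrite -[X in Gamma X]add0r GammaD1E Rintegral_itv_obnd_cbnd; last first.
  exact: integrable_powR_expRN_oy.
rewrite (_ : powR_expRN 0 = fun t : R => expR (- (1 * t))); last first.
  by apply/funext => t; rewrite /powR_expRN powRr0 !mul1r.
by rewrite /Rintegral integral_expRN_scale//= invr1.
Qed.

(** The derivative of [t^(a+1) e^-t] has integral 0 over the half-line. The fundamental theorem of
    calculus is applied to a nonnegative integrand: a multiple of [e^(-t/2)] is added to minus this
    derivative, and its known integral is removed at the end. *)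
Lemma GammaD1 (R : realType) (a : R) : 0 <= a ->
  Gamma (a + 1 + 1) = (a + 1) * Gamma (a + 1).
Proof.
move=> a0; have [C C0 aC] := powR_expRN_bound a0.
have a10 : 0 < a + 1 by rewrite ltr_wpDl.
have h2 : (0 : R) < 2^-1 by [].
pose K := (a + 1) * C.
(* [K e^(-t/2)] makes the derivative of [- t^(a+1) e^-t] nonnegative *)
pose f t := K * expR (- (2^-1 * t))
            - ((a + 1) * powR_expRN a t - powR_expRN (a + 1) t).
have fE : \int[@lebesgue_measure R]_(t in `[0, +oo[) f t = 2 * K.
  rewrite (@Rintegral_ge0_continuous_FTC2y _ _
    (fun t => - (2 * K) * expR (- (2^-1 * t)) - powR_expRN (a + 1) t) _ 0).
  - rewrite /powR_expRN powR0 ?gt_eqF// mul0r mulr0 oppr0 expR0; ring.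
  - move=> x x0; rewrite /f opprB addrA subr_ge0 ler_wpDr ?mulr_ge0 ?powR_ge0 ?expR_ge0//.
    by rewrite -mulrA ler_wpM2l ?aC// ltW.
  - apply/continuous_within_itvcyP; split => [x|].
      rewrite in_itv/= andbT => x0; apply: cvgB.
        by apply: cvgMl_tmp; exact: continuous_expRN_scale.
      apply: cvgB; last exact: powR_expRN_continuous.
      by apply: cvgMl_tmp; exact: powR_expRN_continuous.
    apply: cvgB.
      by apply: cvgMl_tmp; apply: cvg_at_right_filter; exact: continuous_expRN_scale.
    apply: cvgB; last by apply: powR_expRN_cvg0; exact: ltW.
    by apply: cvgMl_tmp; exact: powR_expRN_cvg0.
  - rewrite -[0 : R]subr0 -[X in X - _](mulr0 (- (2 * K))); apply: cvgB.
      by apply: cvgMl_tmp; exact: expRN_scale_cvgy.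
    by apply: powR_expRN_cvgy; exact: ltW.
  - move=> x x0; apply: derivableB.
      by apply: derivableM => //; case: (is_derive_expRN_scale 2^-1 x).
    by case: (is_derive_powR_expRN a x0).
  - apply: cvgB; last by apply: powR_expRN_cvg0; exact: ltW.
    by apply: cvgMl_tmp; apply: cvg_at_right_filter; exact: continuous_expRN_scale.
  - move=> x; rewrite in_itv/= andbT => x0; rewrite derive1E.
    have h := is_deriveB (is_deriveZ (- (2 * K)) (is_derive_expRN_scale 2^-1 x))
                         (is_derive_powR_expRN a x0).
    rewrite (@derive_val _ _ _ _ _ _ _ h) /GRing.scale/= /f.
    by field.
have iE : (@lebesgue_measure R).-integrable `]0, +oo[
    (EFin \o (fun t => expR (- (2^-1 * t)))).
  apply: (integrableS _ _ _ (integrable_expRN_scale h2)) => //.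
  by apply: subset_itvr; rewrite bnd_simp.
have ia := integrable_powR_expRN_oy a0.
have ia1 := integrable_powR_expRN_oy (ltW a10).
have iKE : (@lebesgue_measure R).-integrable `]0, +oo[
    (EFin \o (fun t => K * expR (- (2^-1 * t)))).
  exact: (integrableZl _ K iE).
have iaa : (@lebesgue_measure R).-integrable `]0, +oo[
    (EFin \o (fun t => (a + 1) * powR_expRN a t)).
  exact: (integrableZl _ (a + 1) ia).
have iB : (@lebesgue_measure R).-integrable `]0, +oo[
    (EFin \o (fun t => (a + 1) * powR_expRN a t - powR_expRN (a + 1) t)).
  exact: (integrableB _ iaa ia1).
have E2 : \int[@lebesgue_measure R]_(t in `]0, +oo[) expR (- (2^-1 * t)) = 2.
  rewrite Rintegral_itv_obnd_cbnd//.
  by rewrite /Rintegral integral_expRN_scale//= invrK.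
(* Splitting the integral over the open half-line leaves [2K - ((a + 1) Gamma (a + 1) - Gamma (a +
   2)) = 2K]. *)
move: fE; rewrite -Rintegral_itv_obnd_cbnd; last exact: (integrableB _ iKE iB).
rewrite RintegralB// RintegralZl// RintegralB// RintegralZl//.
rewrite -!GammaD1E E2; lra.
Qed.

(** * Power bounds for ratios of gamma values *)

Lemma Gamma_comb_le (R : realType) (a b c x y z : R) :
  0 <= a -> 0 <= b -> 0 <= c ->
  (forall t, 0 < t -> x * t `^ b + y * t `^ c <= z * t `^ a) ->
  x * Gamma (b + 1) + y * Gamma (c + 1) <= z * Gamma (a + 1).
Proof.
move=> a0 b0 c0 abc; rewrite !GammaD1E.
have [[ia ib] ic] := (integrable_powR_expRN_oy a0, integrable_powR_expRN_oy b0,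
                    integrable_powR_expRN_oy c0).
have iza : (@lebesgue_measure R).-integrable `]0, +oo[
    (EFin \o (fun t => z * powR_expRN a t)) by exact: (integrableZl _ z ia).
have ixb : (@lebesgue_measure R).-integrable `]0, +oo[
    (EFin \o (fun t => x * powR_expRN b t)) by exact: (integrableZl _ x ib).
have iyc : (@lebesgue_measure R).-integrable `]0, +oo[
    (EFin \o (fun t => y * powR_expRN c t)) by exact: (integrableZl _ y ic).
have Zl (r u : R) : 0 <= u -> r * \int[lebesgue_measure]_(t in `]0, +oo[) powR_expRN u t
    = \int[@lebesgue_measure R]_(t in `]0, +oo[) (r * powR_expRN u t).
  by move=> u0; rewrite RintegralZl//; exact: integrable_powR_expRN_oy.
rewrite !Zl// -RintegralD//; apply: le_Rintegral => //.
  exact: (integrableD _ ixb iyc).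
move=> t /=; rewrite in_itv/= andbT => t0.
by rewrite /powR_expRN !mulrA -mulrDl ler_wpM2r ?expR_ge0// abc.
Qed.

(** As a function of [1 / t], the power [t^x] is convex for every [x >= 0]; the left side is its
    tangent at [1 / a]. The proof combines [1 + s <= e^s] with [1 - 1 / u <= ln u] at
    [u = t / a]. *)
Lemma powR_tangent (R : realType) (a t x : R) : 0 < a -> 0 < t -> 0 <= x ->
  a `^ x * (1 + x * (1 - a / t)) <= t `^ x.
Proof.
move=> a0 t0 x0.
have u0 : 0 < t / a by rewrite divr_gt0.
have {2}-> : t = a * (t / a) by field; rewrite gt_eqF.
rewrite powRM ?(ltW a0) ?(ltW u0)// ler_wpM2l ?powR_ge0//.
rewrite /powR gt_eqF//; apply: le_trans (expR_ge1Dx _).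
rewrite lerD2l ler_wpM2l// -[t / a]invrK lnV ?posrE ?invr_gt0// invf_div.
have := @le_ln1Dx R (a / t - 1); rewrite (addrC 1) subrK.
have : 0 < a / t by rewrite divr_gt0.
by move=> ? h; rewrite lerNr opprB; apply: h; rewrite ltrBrDr addrC subrr.
Qed.

(** The tangent bound at [a], times [t^a], is integrated against [e^-t]. The exponent [a - 1] that
    appears is why [1 <= a] is assumed, and [Gamma (a + 1) = a Gamma a] collapses the result. *)
Lemma Gamma_powR_le (R : realType) (a x : R) : 1 <= a -> 0 <= x ->
  a `^ x * Gamma (a + 1) <= Gamma (a + x + 1).
Proof.
move=> a1 x0; have a0 : 0 < a by exact: lt_le_trans a1.
have a10 : 0 <= a - 1 by rewrite subr_ge0.
have := @Gamma_comb_le R (a + x) a (a - 1) (a `^ x * (1 + x)) (- (a `^ x * x * a)) 1.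
have := GammaD1 a10; rewrite subrK => -> h.
rewrite -[leRHS]mul1r.
suff : a `^ x * (1 + x) * (a * Gamma a) + - (a `^ x * x * a) * Gamma a <=
    1 * Gamma (a + x + 1).
  by apply: le_trans; rewrite le_eqVlt; apply/orP; left; apply/eqP; ring.
apply: h => //; rewrite ?addr_ge0 ?(ltW a0)// => t t0.
rewrite mul1r !powRD ?(gt_eqF t0) ?implybT// powRN powRr1 ?(ltW t0)//.
rewrite (_ : _ + _ = t `^ a * (a `^ x * (1 + x * (1 - a / t)))); last ring.
by rewrite ler_wpM2l ?powR_ge0// powR_tangent.
Qed.

(** Here the integration variable is the point of tangency and [mu] the point of evaluation. Taking
    [mu = a + x + 1] lets [Gamma (mu + 1) = mu Gamma mu] collapse the left side to [Gamma mu]. *)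
Lemma Gamma_powR_ge (R : realType) (a x : R) : 0 <= a -> 0 <= x ->
  Gamma (a + x + 1) <= (a + x + 1) `^ x * Gamma (a + 1).
Proof.
move=> a0 x0; have ax0 : 0 <= a + x by exact: addr_ge0.
set mu := a + x + 1; have mu0 : 0 < mu by rewrite ltr_wpDl.
have := @Gamma_comb_le R a (a + x) (a + x + 1) (1 + x) (- (x / mu)) (mu `^ x).
rewrite GammaD1// -/mu => h.
suff : (1 + x) * Gamma mu + - (x / mu) * (mu * Gamma mu) <= mu `^ x * Gamma (a + 1).
  by apply: le_trans; rewrite le_eqVlt; apply/orP; left; apply/eqP; field; rewrite gt_eqF.
apply: h => //; first exact: ltW.
move=> t t0; rewrite /mu !powRD ?(gt_eqF t0) ?implybT// powRr1 ?(ltW t0)// -/mu.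
rewrite (_ : _ + _ = t `^ a * (t `^ x * (1 + x * (1 - t / mu)))); last first.
  by field; rewrite gt_eqF.
by rewrite mulrC ler_wpM2r ?powR_ge0// powR_tangent.
Qed.

(** The case [a = 1] of the lower power bound reads [1 <= Gamma (x + 2) = (x + 1) Gamma (x + 1)]. *)
Lemma GammaD1_ge (R : realType) (x : R) : 0 <= x -> (1 + x)^-1 <= Gamma (x + 1).
Proof.
move=> x0; have x10 : 0 < x + 1 by rewrite ltr_wpDl.
have := Gamma_powR_le (lexx 1) x0.
have {1}-> : (1 : R) + 1 = 0 + 1 + 1 by rewrite add0r.
rewrite GammaD1// !add0r Gamma1 powR1 !mulr1 (addrC 1 x) GammaD1//.
by rewrite -ler_pdivrMl// mulr1.
Qed.

Lemma GammaD1_gt0 (R : realType) (x : R) : 0 <= x -> 0 < Gamma (x + 1).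
Proof.
by move=> x0; apply: lt_le_trans (GammaD1_ge x0); rewrite invr_gt0 ltr_wpDr.
Qed.

(** * Gauss's limit formula *)

Lemma is_derive_shift_invX (R : realType) (c x : R) (n : nat) : 0 < x + c ->
  is_derive x 1 (fun y => (y + c) ^- n.+1) (- (n.+1%:R * (x + c) ^- n.+2)).
Proof.
move=> xc0.
have hs : is_derive x 1 (fun y : R => y + c) 1.
  by apply: is_derive_eq; rewrite addr0.
have hX : is_derive x 1 (fun y => (y + c) ^+ n.+1) ((n.+1%:R * (x + c) ^+ n) *: 1).
  have -> : (fun y => (y + c) ^+ n.+1) = (fun y => y + c) ^+ n.+1.
    by apply/funext => y; rewrite exprfctE.
  exact: is_deriveX.
have hV : is_derive x 1 (fun y : R => (y + c) ^- n.+1)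
    (- ((x + c) ^+ n.+1) ^- 2 *: ((n.+1%:R * (x + c) ^+ n) *: 1)).
  apply: (@is_deriveV _ (fun y => (y + c) ^+ n.+1) _ _ _ _ hX).
  by rewrite expf_neq0// gt_eqF.
apply: is_derive_eq hV _; rewrite /GRing.scale/= !exprS.
by field; rewrite ?expf_neq0 gt_eqF.
Qed.

(* The [n]-th derivative of [ln (x + c)]. *)
Definition ln_shift (R : realType) (c : R) (n : nat) (x : R) : R :=
  if n is m.+1 then (-1) ^+ m * m`!%:R * (x + c) ^- m.+1 else ln (x + c).

Lemma ln_shift_derives (R : realType) (c : R) (n : nat) : 0 <= c ->
  derives_pos (ln_shift c n) (ln_shift c n.+1).
Proof.
move=> c0 x x0; have xc0 : 0 < x + c by rewrite ltr_wpDr.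
case: n => [|n] /=.
  have hs : is_derive x 1 (fun y : R => y + c) 1.
    by apply: is_derive_eq; rewrite addr0.
  have := is_derive1_comp (g := fun y => y + c) (is_derive1_ln xc0) hs.
  by move=> /is_derive_eq; apply; rewrite expr0 fact0 !mul1r mulr1 expr1.
have := is_deriveZ ((-1) ^+ n * n`!%:R) (is_derive_shift_invX n xc0).
move=> /is_derive_eq; apply; rewrite /GRing.scale/= factS natrM (exprS (-1)).
by ring.
Qed.

Lemma derives_pos_sum (R : realType) (h h' : nat -> R -> R) (N : nat) :
  (forall k, derives_pos (h k) (h' k)) ->
  derives_pos (fun x => \sum_(k < N) h k x) (fun x => \sum_(k < N) h' k x).
Proof.
move=> hh' x x0.
have -> : (fun x => \sum_(k < N) h k x) = \sum_(k < N) h k.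
  by apply/funext => y; rewrite fct_sumE.
by apply: is_derive_sum => k; exact: hh'.
Qed.

(* The [n]-th derivative of [x ln N + sum_(k <= N) (ln k - ln (x + k))], with
   [N.+1] for [N], is split into [gauss_affine] and the logarithms [ln (x + k)]. *)
Definition gauss_affine (R : realType) (N n : nat) (x : R) : R :=
  match n with
  | 0 => x * ln N.+1%:R + \sum_(k < N.+1) ln k.+1%:R
  | 1 => ln N.+1%:R
  | _ => 0
  end.

Definition gauss_tower (R : realType) (N n : nat) (x : R) : R :=
  gauss_affine N n x - \sum_(k < N.+1) ln_shift k.+1%:R n x.

Lemma gauss_tower_derives (R : realType) (N n : nat) :
  derives_pos (@gauss_tower R N n) (gauss_tower N n.+1).
Proof.
move=> x x0; rewrite /gauss_tower.
have hs := derives_pos_sum N.+1 (fun k => @ln_shift_derives R k.+1%:R n (ler0n _ _)) x0.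
have ha : is_derive x 1 (@gauss_affine R N n) (gauss_affine N n.+1 x).
  case: n {hs} => [|[|n]] /=; [|exact: is_derive_cst..].
  by apply: is_derive_eq; rewrite /GRing.scale/= addr0 mulr1 mulr0 add0r.
exact: (is_deriveB ha hs).
Qed.

(** From order 2 on the affine part is gone, and the sign of the derivatives of the logarithm
    cancels the subtraction. *)
Lemma gauss_towerSS (R : realType) (N n : nat) (x : R) :
  (-1) ^+ n * gauss_tower N n.+2 x =
  n.+1`!%:R * \sum_(k < N.+1) (x + k.+1%:R) ^- n.+2.
Proof.
rewrite /gauss_tower/= sub0r -mulr_sumr exprS !mulNr mul1r opprK !mulrA.
by rewrite -expr2 sqrr_sign mul1r.
Qed.

(** This is Bernoulli's inequality for [(1 + 1 / y)^(m+1)], cleared of denominators. *)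
Lemma bernoulli_like (R : realType) (y : R) (m : nat) : 0 <= y ->
  (m%:R + y + 1) * y ^+ m <= (y + 1) ^+ m.+1.
Proof.
move=> y0; elim: m => [|m IHm]; first by rewrite expr0 expr1 mulr1 add0r.
rewrite [leRHS]exprS; apply: le_trans (ler_wpM2l _ IHm); last by rewrite addr_ge0.
rewrite exprS !mulrA ler_wpM2r ?exprn_ge0// -natr1.
have := ler0n R m; nra.
Qed.

Lemma sum_shift_invX_le (R : realType) (M n : nat) (x : R) : 0 < x ->
  n.+1%:R * (\sum_(k < M) (x + k.+1%:R) ^- n.+2) <= x ^- n.+1 - (x + M%:R) ^- n.+1.
Proof.
move=> x0; elim: M => [|M IHM]; first by rewrite big_ord0 mulr0 addr0 subrr.
rewrite big_ord_recr/= mulrDr.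
have y0 : 0 < x + M%:R by rewrite ltr_wpDr.
(* One telescoping step; with [y = x + M] it becomes [bernoulli_like] for [m = n + 1]. *)
suff : n.+1%:R * (x + M.+1%:R) ^- n.+2 <= (x + M%:R) ^- n.+1 - (x + M.+1%:R) ^- n.+1.
  move: IHM; lra.
rewrite -(natr1 M) addrA; move: (x + M%:R) y0 => y y0 {IHM}.
have z0 : 0 < y + 1 by rewrite addr_gt0.
rewrite lerBrDr.
have -> : n.+1%:R * (y + 1) ^- n.+2 + (y + 1) ^- n.+1 =
    (n.+1%:R + y + 1) / (y + 1) ^+ n.+2.
  by rewrite [in RHS]exprS exprS; field; rewrite ?expf_neq0 gt_eqF.
rewrite ler_pdivrMr ?exprn_gt0// mulrC ler_pdivlMr ?exprn_gt0//.
by apply: bernoulli_like; exact: ltW.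
Qed.

Lemma sum_shift_invX_ge0 (R : realType) (M n : nat) (x : R) : 0 < x ->
  0 <= \sum_(k < M) (x + k.+1%:R) ^- n.
Proof.
by move=> x0; apply: sumr_ge0 => k _; rewrite invr_ge0 exprn_ge0// addr_ge0// ltW.
Qed.

(** The bound has to be uniform in [x] as well as in [N]. The first term is at most 1, and the
    others form the telescoping sum started at [x + 1], which stays away from 0. *)
Lemma sum_shift_invX_le2 (R : realType) (N n : nat) (x : R) : 0 < x ->
  \sum_(k < N.+1) (x + k.+1%:R) ^- n.+2 <= 2.
Proof.
move=> x0; have x10 : 0 < x + 1 by rewrite addr_gt0.
have le1 m : (x + 1) ^- m <= 1.
  by rewrite invf_le1 ?exprn_gt0// exprn_ege1// lerDr ltW.
rewrite big_ord_recl/= (_ : 2 = 1 + 1 :> R)//; apply: lerD; first exact: le1.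
under eq_bigr => k _ do rewrite /bump/= add1n -(natr1 k.+1) (addrC k.+1%:R) addrA.
have := sum_shift_invX_le N n x10.
have := @sum_shift_invX_ge0 R N n.+2 _ x10.
set S := \sum_(_ < _) _ => S0 h.
apply: (@le_trans _ _ (n.+1%:R * S)); first by rewrite ler_peMl// ler1n.
apply: (le_trans h); apply: le_trans (le1 n.+1).
by rewrite lerBlDr lerDl invr_ge0 exprn_ge0// addr_ge0// ltW.
Qed.

Lemma gauss_towerSS_bounds (R : realType) (N n : nat) (x : R) : 0 < x ->
  0 <= (-1) ^+ n * gauss_tower N n.+2 x <= n`!%:R / x ^+ n.+1.
Proof.
move=> x0; rewrite gauss_towerSS mulr_ge0 ?sum_shift_invX_ge0//=.
rewrite factS mulnC natrM -mulrA ler_wpM2l//.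
apply: le_trans (sum_shift_invX_le _ _ x0) _.
by rewrite lerBlDr lerDl invr_ge0 exprn_ge0// addr_ge0// ltW.
Qed.

Lemma gauss_towerSS_norm (R : realType) (N n : nat) (x : R) : 0 < x ->
  `|gauss_tower N n.+2 x| <= n.+1`!%:R * 2.
Proof.
move=> x0.
have -> : `|gauss_tower N n.+2 x| = `|(-1) ^+ n * gauss_tower N n.+2 x|.
  by rewrite normrM normrX normrN1 expr1n mul1r.
rewrite gauss_towerSS ger0_norm ?mulr_ge0 ?sum_shift_invX_ge0//.
by rewrite ler_wpM2l// sum_shift_invX_le2.
Qed.

Definition lnGamma1 (R : realType) (x : R) : R := ln (Gamma (x + 1)).

Lemma lnGamma1_shift (R : realType) (x : R) (M : nat) : 0 <= x ->
  lnGamma1 (x + M%:R) = lnGamma1 x + \sum_(k < M) ln (x + k.+1%:R).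
Proof.
move=> x0; elim: M => [|M IHM]; first by rewrite big_ord0 !addr0.
rewrite big_ord_recr/= addrA -IHM /lnGamma1 -(natr1 M) !addrA.
have xM0 : 0 <= x + M%:R by rewrite addr_ge0.
rewrite GammaD1// lnM ?posrE ?GammaD1_gt0 ?ltr_wpDl//.
by rewrite [LHS]addrC.
Qed.

Lemma lnGamma1_0 (R : realType) : lnGamma1 (0 : R) = 0.
Proof. by rewrite /lnGamma1 add0r Gamma1 ln1. Qed.

(** Iterating the functional equation moves the error to the large argument [N + 1], where the power
    bounds are sharp. *)
Lemma gauss_tower0E (R : realType) (N : nat) (x : R) : 0 <= x ->
  lnGamma1 x - gauss_tower N 0 x =
  lnGamma1 (N.+1%:R + x) - lnGamma1 (N.+1%:R : R) - x * ln N.+1%:R.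
Proof.
move=> x0; have lnN : lnGamma1 (N.+1%:R : R) = \sum_(k < N.+1) ln k.+1%:R.
  rewrite -[X in lnGamma1 X]add0r lnGamma1_shift// lnGamma1_0 add0r.
  by apply: eq_bigr => k _; rewrite add0r.
rewrite lnN (addrC _ x) lnGamma1_shift// /gauss_tower/=; ring.
Qed.

(** The power bounds at [a = N + 1] place the error between 0 and [x ln ((N + x + 2) / (N + 1))]. *)
Lemma gauss_tower0_dist (R : realType) (N : nat) (x : R) : 0 <= x ->
  `|lnGamma1 x - gauss_tower N 0 x| <= x * (x + 1) / N.+1%:R.
Proof.
move=> x0; rewrite gauss_tower0E//.
have N1 : (1 : R) <= N.+1%:R by rewrite ler1n.
have N0 : 0 < (N.+1%:R : R) by [].
have G0 := @GammaD1_gt0 R N.+1%:R (ltW N0).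
have Gx0 : 0 < Gamma (N.+1%:R + x + 1) by rewrite GammaD1_gt0 ?addr_ge0.
have Nx0 : 0 < N.+1%:R + x + 1 by rewrite ltr_wpDl ?addr_ge0.
have := Gamma_powR_le N1 x0.
rewrite -ler_ln ?posrE ?mulr_gt0 ?powR_gt0// lnM ?posrE ?powR_gt0// ln_powR => lo.
have := Gamma_powR_ge (ltW N0) x0.
rewrite -ler_ln ?posrE ?mulr_gt0 ?powR_gt0// lnM ?posrE ?powR_gt0// ln_powR => hi.
have lnle : ln (N.+1%:R + x + 1) - ln N.+1%:R <= (x + 1) / N.+1%:R.
  rewrite -ln_div ?posrE//.
  have -> : (N.+1%:R + x + 1) / N.+1%:R = 1 + (x + 1) / N.+1%:R.
    by field; rewrite gt_eqF.
  by apply: le_ln1Dx; apply: (@lt_le_trans _ _ 0) => //; rewrite divr_ge0 ?addr_ge0.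
rewrite ger0_norm /lnGamma1; last by move: lo; lra.
have h := ler_wpM2l x0 lnle; rewrite mulrBr mulrA in h.
by apply: le_trans h; rewrite lerD2r lerBlDr.
Qed.

Lemma gauss_tower0_cvg (R : realType) (x : R) : 0 <= x ->
  gauss_tower N 0 x @[N --> \oo] --> lnGamma1 x.
Proof.
move=> x0; apply/cvgrPdist_le => e e0.
have h : x * (x + 1) / N.+1%:R @[N --> \oo] --> (0 : R).
  by rewrite -[0](mulr0 (x * (x + 1))); apply: cvgMl_tmp; exact: cvg_harmonic.
have /cvgrPdist_le/(_ _ e0) := h.
apply: filterS => N; rewrite sub0r normrN => hN.
exact: le_trans (gauss_tower0_dist N x0) (le_trans (ler_norm _) hN).
Qed.

Lemma lnGamma1_tower (R : realType) : exists D : nat -> R -> R, [/\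
  forall x, 0 < x -> D 0%N x = lnGamma1 x,
  forall n, derives_pos (D n) (D n.+1),
  forall n x, 0 < x -> 0 <= (-1) ^+ n * D n.+2 x <= n`!%:R / x ^+ n.+1 &
  forall n x, 0 < x -> `|D n.+2 x| <= n.+1`!%:R * 2].
Proof.
have [cT dT] := limit_tower (@gauss_tower_derives R) (@gauss_towerSS_norm R)
  (fun x x0 => cvgP _ (gauss_tower0_cvg (ltW x0))).
exists (fun n x => limn (fun N => gauss_tower N n x)); split => //.
- by move=> x x0; apply/cvg_lim => //; exact/gauss_tower0_cvg/ltW.
- move=> n x x0.
  have h : (-1) ^+ n * gauss_tower N n.+2 x @[N --> \oo] -->
      (-1) ^+ n * limn (fun N => gauss_tower N n.+2 x).
    by apply: cvgMl_tmp; exact: cT.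
  apply/andP; split.
    by apply: (cvgr_to_ge h); apply: nearW => N; case/andP: (gauss_towerSS_bounds N n x0).
  by apply: (cvgr_to_le h); apply: nearW => N; case/andP: (gauss_towerSS_bounds N n x0).
- move=> n x x0; apply: (cvgr_to_le (cvg_norm (cT _ _ x0))).
  by apply: nearW => N; exact: gauss_towerSS_norm.
Qed.

(** * The quotient [ln (Gamma (x + 1)) / x] *)

(* [x ^+ n.+1] times the [n]-th derivative of [D 0 x / x], where [D n] is the
   [n]-th derivative of [D 0]. *)
Fixpoint quot_num (R : realType) (D : nat -> R -> R) (n : nat) (x : R) : R :=
  if n is m.+1 then x ^+ n * D n x - n%:R * quot_num D m x else D 0%N x.

Lemma is_derive_idX (R : realType) (x : R) (n : nat) :
  is_derive x 1 (fun y => y ^+ n.+1) (n.+1%:R * x ^+ n).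
Proof.
have -> : (fun y => y ^+ n.+1) = (@id R) ^+ n.+1.
  by apply/funext => y; rewrite exprfctE.
by have /is_derive_eq := is_deriveX n.+1 (is_derive_id x (1 : R)); apply;
  rewrite /GRing.scale/= mulr1.
Qed.

(** The recursion is made so that the two terms [(n + 1) x^n D (n + 1)] cancel on
    differentiation. *)
Lemma quot_num_derives (R : realType) (D : nat -> R -> R) (n : nat) :
  (forall n, derives_pos (D n) (D n.+1)) ->
  derives_pos (quot_num D n) (fun x => x ^+ n * D n.+1 x).
Proof.
move=> dD; elim: n => [|n IHn] x x0; first by rewrite expr0 mul1r; exact: dD.
have := is_deriveB (is_deriveM (is_derive_idX x n) (dD n.+1 x x0))
                   (is_deriveZ n.+1%:R (IHn x x0)).
move=> /is_derive_eq; apply; rewrite /GRing.scale/= !exprS; ring.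
Qed.

Definition quot_tower (R : realType) (D : nat -> R -> R) (n : nat) (x : R) : R :=
  quot_num D n x * x ^- n.+1.

Lemma quot_tower_derives (R : realType) (D : nat -> R -> R) (n : nat) :
  (forall n, derives_pos (D n) (D n.+1)) ->
  derives_pos (quot_tower D n) (quot_tower D n.+1).
Proof.
move=> dD x x0.
have hV : is_derive x 1 (fun y => y ^- n.+1) (- (n.+1%:R * x ^- n.+2)).
  have x00 : 0 < x + 0 by rewrite addr0.
  have := is_derive_shift_invX n x00; rewrite addr0.
  by under eq_fun do rewrite addr0.
have := is_deriveM (quot_num_derives n dD x0) hV.
move=> /is_derive_eq; apply; rewrite /GRing.scale/= /quot_tower /= !exprS.
by field; rewrite ?expf_neq0 gt_eqF.
Qed.

(** Provides the linear bound near 0 that [nonneg_pos] asks for: on []0, 1]] the factor [x^(n+1)]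
    times a bounded derivative is of order [x]. *)
Lemma quot_num_small (R : realType) (D : nat -> R -> R) (n : nat) :
  (forall n, exists C, forall x, 0 < x <= 1 -> `|D n.+1 x| <= C) ->
  (forall x, 0 < x <= 1 -> `|D 0%N x| <= x) ->
  exists C, forall x, 0 < x <= 1 -> `|quot_num D n x| <= C * x.
Proof.
move=> DC D0; elim: n => [|n [C IHn]]; first by exists 1 => x /D0; rewrite mul1r.
have [C' hC'] := DC n; exists (C' + n.+1%:R * C) => x x01 /=.
have [x0 x1] := andP x01.
apply: (le_trans (ler_normB _ _)); rewrite mulrDl !normrM normr_nat normrX.
apply: lerD; last by rewrite -mulrA ler_wpM2l// IHn.
rewrite (gtr0_norm x0) mulrC ler_pM ?exprn_ge0 ?(ltW x0) ?hC'//.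
by rewrite exprS ler_piMr ?(ltW x0)// exprn_ile1// ltW.
Qed.

(** The derivative [(-1)^n x^(n+1) D (n + 2)] lies between 0 and [n!], so this function and its
    difference from [n! x] are both nondecreasing, starting from 0. *)
Lemma quot_num_bounds (R : realType) (D : nat -> R -> R) (n : nat) (x : R) :
  (forall n, derives_pos (D n) (D n.+1)) ->
  (forall n, exists C, forall x, 0 < x <= 1 -> `|D n.+1 x| <= C) ->
  (forall x, 0 < x <= 1 -> `|D 0%N x| <= x) ->
  (forall n x, 0 < x -> 0 <= (-1) ^+ n * D n.+2 x <= n`!%:R / x ^+ n.+1) ->
  0 < x -> 0 <= (-1) ^+ n * quot_num D n.+1 x <= n`!%:R * x.
Proof.
move=> dD DC D0 Dsgn x0.
have [C qC] := quot_num_small n.+1 DC D0.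
have sC y : 0 < y <= 1 -> `|(-1) ^+ n * quot_num D n.+1 y| <= C * y.
  by move=> /qC; rewrite normrM normrX normrN1 expr1n mul1r.
have dq : derives_pos (fun y => (-1) ^+ n * quot_num D n.+1 y)
    (fun y => (-1) ^+ n * (y ^+ n.+1 * D n.+2 y)).
  by move=> y y0; exact: (is_deriveZ ((-1) ^+ n) (quot_num_derives n.+1 dD y0)).
have dq' : derives_pos (fun y => n`!%:R * y - (-1) ^+ n * quot_num D n.+1 y)
    (fun y => n`!%:R - (-1) ^+ n * (y ^+ n.+1 * D n.+2 y)).
  move=> y y0; have := is_deriveB (is_deriveZ n`!%:R (is_derive_id y (1 : R))) (dq y y0).
  by move=> /is_derive_eq; apply; rewrite /GRing.scale/= mulr1.
apply/andP; split.
  apply: (nonneg_pos dq (C := C) _ _ x0) => [z z0|y /sC].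
    by rewrite mulrCA mulr_ge0 ?exprn_ge0 ?(ltW z0)//; case/andP: (Dsgn n z z0).
  by rewrite ler_norml => /andP[].
rewrite -subr_ge0; apply: (nonneg_pos dq' (C := C) _ _ x0) => [z z0|y y01].
  rewrite subr_ge0 mulrCA mulrC -ler_pdivlMr ?exprn_gt0//.
  by case/andP: (Dsgn n z z0).
have := sC y y01; rewrite ler_norml => /andP[_ h].
have : 0 <= n`!%:R * y by case/andP: y01 => y0 _; rewrite mulr_ge0// ltW.
lra.
Qed.

Lemma lnGamma1_ge (R : realType) (x : R) : 0 <= x -> - x <= lnGamma1 x.
Proof.
move=> x0; have x10 : 0 < 1 + x by rewrite ltr_wpDr.
have := GammaD1_ge x0.
rewrite -ler_ln ?posrE ?invr_gt0 ?GammaD1_gt0// lnV ?posrE//; apply: le_trans.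
by rewrite lerN2 le_ln1Dx// (lt_le_trans _ x0).
Qed.

(** The upper power bound at [a = 0] is [Gamma (x + 1) <= (x + 1)^x], and [ln (1 + x) <= x]. *)
Lemma lnGamma1_le (R : realType) (x : R) : 0 <= x -> lnGamma1 x <= x * x.
Proof.
move=> x0; have x10 : 0 < x + 1 by rewrite ltr_wpDl.
have := Gamma_powR_ge (lexx 0) x0; rewrite !add0r Gamma1 mulr1.
rewrite -ler_ln ?posrE ?powR_gt0 ?GammaD1_gt0// ln_powR => /le_trans; apply.
by rewrite ler_wpM2l// addrC le_ln1Dx// (lt_le_trans _ x0).
Qed.

Lemma Gamma_nat (R : realType) (n : nat) : Gamma (n%:R + 1 : R) = n`!%:R.
Proof.
elim: n => [|n IHn]; first by rewrite add0r Gamma1.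
by rewrite -natr1 GammaD1// IHn factS natrM natr1.
Qed.

(** A single term of the exponential series gives [N^N / N! <= e^N]. *)
Lemma lnGamma1_nat_ge (R : realType) (n : nat) :
  n.+1%:R * ln n.+1%:R - n.+1%:R <= lnGamma1 (n.+1%:R : R).
Proof.
have N0 : 0 < (n.+1%:R : R) by [].
have F0 : 0 < (n.+1`!%:R : R) by rewrite ltr0n fact_gt0.
rewrite /lnGamma1 Gamma_nat lerBlDr.
have -> : n.+1%:R * ln n.+1%:R = ln (n.+1%:R ^+ n.+1 : R).
  by rewrite lnXn// -[RHS]mulr_natl.
rewrite -[X in _ + X]expRK -lnM ?posrE ?expR_gt0//.
rewrite ler_ln ?posrE ?mulr_gt0 ?expR_gt0 ?exprn_gt0// mulrC -ler_pdivrMr//.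
by apply: le_trans (@expR_ge1Dxn R n.+1%:R n (ltW N0)); rewrite lerDr.
Qed.

(** * Logarithmic complete monotonicity as sign conditions, and the theorem *)

Lemma log_completely_monotonic_tower (R : realType) (f : R -> R)
    (H : nat -> R -> R) :
  (forall n, derives_pos (H n) (H n.+1)) ->
  (forall x, 0 < x -> f x = expR (H 0%N x)) ->
  log_completely_monotonic `]0, +oo[ f <->
  (forall n x, 0 < x -> 0 <= (-1) ^+ n.+1 * H n.+1 x).
Proof.
move=> dH fH.
have lnfH x : 0 < x -> ln (f x) = H 0%N x by move=> x0; rewrite fH// expRK.
have lnfE := @derive1n_tower R H (fun y => ln (f y)) dH lnfH.
split=> [[_ _ sgn] n x x0|sgn].
  by rewrite -lnfE//; apply: sgn => //=; rewrite in_itv/= x0.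
have pos x : `]0, +oo[%classic x -> 0 < x by rewrite /= in_itv/= andbT.
split=> [x /pos x0|n x /pos x0|[//|n] x _ /pos x0].
- by rewrite fH// expR_gt0.
- apply: smooth_pos_derivable x0; apply: smooth_pos_eq; last first.
    by apply: smooth_pos_expR; exact: (smooth_pos_tower dH n.+1 0).
  by move=> y y0 /=; rewrite fH.
- by rewrite lnfE// sgn.
Qed.

Lemma lnGamma1_quot_tower (R : realType) : exists G : nat -> R -> R, [/\
  forall n, derives_pos (G n) (G n.+1),
  forall x, 0 < x -> G 0%N x = lnGamma1 x / x &
  forall n x, 0 < x -> 0 <= (-1) ^+ n * G n.+1 x <= n`!%:R / x ^+ n.+1].
Proof.
have [D [D0 dD Dsgn DB]] := lnGamma1_tower R.
have DC n : exists C, forall x, 0 < x <= 1 -> `|D n.+1 x| <= C.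
  case: n => [|n]; last by exists (n.+1`!%:R * 2) => x /andP[x0 _]; exact: DB.
  (* Order 1 is not covered by the uniform bounds; it is compared with its value at 1 through the
     bound on order 2. *)
  exists (`|D 1%N 1| + 1`!%:R * 2) => x /andP[x0 x1].
  have [c [c0 _ DE]] := MVT_pos (dD 1%N) ltr01 x0.
  rewrite -[D 1%N x](subrKC (D 1%N 1)); apply: (le_trans (ler_normD _ _)).
  rewrite lerD2l DE normrM -[leRHS]mulr1 ler_pM// ?DB//.
  by rewrite ler_norml; apply/andP; split; lra.
have D01 x : 0 < x <= 1 -> `|D 0%N x| <= x.
  move=> /andP[x0 x1]; rewrite D0// ler_norml lnGamma1_ge ?(ltW x0)//=.
  by apply: (le_trans (lnGamma1_le (ltW x0))); rewrite ler_piMl// ltW.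
exists (quot_tower D); split=> [n|x x0|n x x0].
- exact: quot_tower_derives.
- by rewrite /quot_tower/= D0// expr1.
- rewrite /quot_tower mulrA.
  have /andP[lo hi] := quot_num_bounds n dD DC D01 Dsgn x0.
  rewrite mulr_ge0 ?invr_ge0 ?exprn_ge0 ?(ltW x0)//=.
  rewrite ler_pdivrMr ?exprn_gt0//; apply: (le_trans hi).
  rewrite (exprS x n.+1) (mulrC x) mulrA divfK// expf_neq0// gt_eqF//.
Qed.

(* The factor [n`! / x ^+ n.+1] is [(-1) ^+ n] times the [n.+1]-st derivative
   of [ln]. *)
Lemma log_completely_monotonic_comb (R : realType) (f : R -> R) (a b : R)
    (G : nat -> R -> R) :
  (forall n, derives_pos (G n) (G n.+1)) ->
  (forall x, 0 < x -> f x = expR (a * G 0%N x + b * ln x)) ->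
  log_completely_monotonic `]0, +oo[ f <->
  (forall n x, 0 < x ->
     a * ((-1) ^+ n * G n.+1 x) + b * (n`!%:R / x ^+ n.+1) <= 0).
Proof.
move=> dG fE; pose H n x := a * G n x + b * ln_shift 0 n x.
have dH n : derives_pos (H n) (H n.+1).
  move=> x x0; exact: (is_deriveD (is_deriveZ a (dG n x x0))
    (is_deriveZ b (ln_shift_derives n (lexx 0) x0))).
have fH x : 0 < x -> f x = expR (H 0%N x) by move=> x0; rewrite fE// /H/= addr0.
have HS n x : (-1) ^+ n.+1 * H n.+1 x =
    - (a * ((-1) ^+ n * G n.+1 x) + b * (n`!%:R / x ^+ n.+1)).
  rewrite /H/= addr0 exprS.
  (* A squared sign is inserted so that both sides become equal as polynomials in [(-1)^n]. *)
  have -> : b * (n`!%:R / x ^+ n.+1) =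
      b * ((-1) ^+ n * ((-1) ^+ n * n`!%:R / x ^+ n.+1)).
    by rewrite (mulrA (_ ^+ n) _ (_^-1)) (mulrA (_ ^+ n) (_ ^+ n)) -expr2 sqrr_sign mul1r.
  by ring.
rewrite (log_completely_monotonic_tower dH fH).
by split=> h n x /(h n); rewrite HS oppr_ge0.
Qed.

(** The instance [n = 0] says that the first derivative is nonpositive. Both necessity claims rest
    on this monotonicity. *)
Lemma comb_nonincreasing (R : realType) (a b : R) (G : nat -> R -> R) :
  derives_pos (G 0%N) (G 1%N) ->
  (forall n x, 0 < x ->
     a * ((-1) ^+ n * G n.+1 x) + b * (n`!%:R / x ^+ n.+1) <= 0) ->
  forall x y, 0 < x -> x <= y ->
  a * G 0%N y + b * ln y <= a * G 0%N x + b * ln x.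
Proof.
move=> dG sgn x y x0 xy; rewrite -lerN2.
apply: (@nondecreasing_pos _ (fun z => - (a * G 0%N z + b * ln z))
  (fun z => - (a * G 1%N z + b * z^-1)) _ _ _ _ x0 xy) => z z0; last first.
  by have := sgn 0%N z z0; rewrite expr0 fact0 expr1 !mul1r oppr_ge0.
exact: (is_deriveN (is_deriveD (is_deriveZ a (dG z z0))
  (is_deriveZ b (is_derive1_ln z0)))).
Qed.

Theorem theorem3 (R : realType) (alpha : R) :
  (log_completely_monotonic `]0, +oo[
     (fun x : R => x `^ alpha / (Gamma (x + 1)) `^ (1 / x))
   <-> alpha <= 0) /\
  (log_completely_monotonic `]0, +oo[
     (fun x : R => (Gamma (x + 1)) `^ (1 / x) / x `^ alpha)
   <-> 1 <= alpha).
Proof.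
have [G [dG G0 Gsgn]] := lnGamma1_quot_tower R.
have powE x : 0 < x -> x `^ alpha = expR (alpha * ln x).
  by move=> x0; rewrite /powR gt_eqF.
have rootE x : 0 < x -> Gamma (x + 1) `^ (1 / x) = expR (G 0%N x).
  move=> x0; rewrite /powR gt_eqF ?GammaD1_gt0 ?(ltW x0)// G0//.
  by rewrite mulrC mulrA mulr1.
set c := G 0%N 1.
split.
  have fE x : 0 < x -> x `^ alpha / (Gamma (x + 1)) `^ (1 / x) =
      expR ((-1) * G 0%N x + alpha * ln x).
    by move=> x0; rewrite powE// rootE// -expRN -expRD mulN1r addrC.
  rewrite (log_completely_monotonic_comb dG fE); split=> [sgn|a0 n x x0].
    rewrite leNgt; apply/negP => a0.
    (* Chosen so that [alpha * ln x = - (|c| + 2)]. Comparing [x] with 1 gives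
       [- c <= - G 0 x - (|c| + 2)], which [G 0 x >= -1] turns into [|c| + 1 <= c]. *)
    pose t := (`|c| + 2) / alpha; pose x := expR (- t).
    have t0 : 0 < t by rewrite divr_gt0// ltr_wpDl.
    have x0 : 0 < x by exact: expR_gt0.
    have x1 : x <= 1 by rewrite expR_le1 oppr_le0 ltW.
    have := comb_nonincreasing (dG 0%N) sgn x0 x1.
    rewrite ln1 mulr0 addr0 -/c G0// {2}/x expRK mulrN.
    have -> : alpha * t = `|c| + 2 by rewrite /t; field; rewrite gt_eqF.
    have : -1 <= lnGamma1 x / x.
      by rewrite ler_pdivlMr// mulN1r lnGamma1_ge// ltW.
    have := ler_norm c; lra.
  have /andP[lo _] := Gsgn n x x0.
  rewrite mulN1r addrC subr_le0; apply: le_trans lo.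
  by rewrite mulr_le0_ge0// divr_ge0// exprn_ge0// ltW.
have fE x : 0 < x -> (Gamma (x + 1)) `^ (1 / x) / x `^ alpha =
    expR (1 * G 0%N x + - alpha * ln x).
  by move=> x0; rewrite powE// rootE// -expRN -expRD mul1r mulNr.
rewrite (log_completely_monotonic_comb dG fE); split=> [sgn|a1 n x x0].
  rewrite leNgt; apply/negP => a1; have a0 : 0 < 1 - alpha by rewrite subr_gt0.
  (* Any integer [N >= y] has [(1 - alpha) ln N >= |c| + 2]. Comparing 1 with [N] and using
     [G 0 N >= ln N - 1] gives [(1 - alpha) ln N - 1 <= c], a contradiction. *)
  pose y := expR ((`|c| + 2) / (1 - alpha)).
  have y0 : 0 < y by exact: expR_gt0.
  have := archi_boundP (ltW y0); set m := Num.bound y => ym.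
  have yN : y <= m.+1%:R by rewrite (le_trans (ltW ym))// ler_nat.
  have N0 : 0 < (m.+1%:R : R) by [].
  have lnN : `|c| + 2 <= (1 - alpha) * ln m.+1%:R.
    rewrite mulrC -ler_pdivrMr// -[leLHS]expRK ler_ln ?posrE ?expR_gt0//.
  have := comb_nonincreasing (dG 0%N) sgn ltr01 (_ : 1 <= m.+1%:R).
  rewrite ler1n => /(_ isT); rewrite ln1 mulr0 addr0 !mul1r -/c G0//.
  have : ln m.+1%:R - 1 <= lnGamma1 (m.+1%:R : R) / m.+1%:R.
    rewrite ler_pdivlMr// mulrBl mul1r (mulrC (ln _)).
    exact: lnGamma1_nat_ge.
  move: lnN (ler_norm c); rewrite mulrBl mul1r mulNr.
  move: (lnGamma1 _ / _) => q; move: (ln _) => l; move: (alpha * l) => al; lra.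
(* Sufficiency uses the upper bound [n! / x^(n+1)], which is at most [alpha] times itself as
   [1 <= alpha]. *)
have /andP[_ hi] := Gsgn n x x0.
rewrite mul1r mulNr subr_le0; apply: (le_trans hi).
by rewrite ler_peMl// divr_ge0// exprn_ge0// ltW.
Qed.
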